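(* Let $x: M \rightarrow \mathbb{C}^m$ be a totally real isometric immersion of an $n$-dimensional connected Riemannian manifold into $\mathbb{C}^m$. Then (1) if the mean curvature vector field $H$ of $x$ is parallel in the normal bundle, then the Laplace map of $x$ is totally real; and (2) if $M$ has parallel normalized mean curvature vector field and $m=n$, then the Laplace map is totally real if and only if $A_{H}JH$ is parallel to the gradient $\nabla\alpha$ of the mean curvature function $\alpha$.
   Context: Everything is smooth; $M$ is connected. $\mathbb{C}^m$ carries its standard flat Kähler metric and complex structure $J$. A map $x:M\to\mathbb{C}^m$ (not necessarily an immersion) is totally real if $J(dx(T_pM))\subset (dx(T_pM))^{\perp}$ for every $p\in M$. $\Delta=-\operatorname{trace}\nabla^2$ is the Laplace operator of $M$; the Laplace map is $L:M\to\mathbb{C}^m$, $L(p)=(\Delta x)(p)=-nH(p)$, with $H=\frac1n\operatorname{trace}h$ the mean curvature vector and $\alpha=\|H\|$. $A_\xi$ is the Weingarten (shape) operator in the normal direction $\xi$. Parallel normalized mean curvature vector means that $H$ is nowhere zero and the unit normal field $\xi=H/\alpha$ is parallel in the normal bundle. When $m=n$, $J$ maps normal vectors to tangent vectors, so $JH$ is tangent. ''$A_HJH$ is parallel to $\nabla\alpha$'' means that these two tangent vector fields are linearly dependent at every point. *)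

(* Defs.v *)
From HB Require Import structures.
From mathcomp Require Import all_boot all_order all_algebra.
From mathcomp Require Import all_classical all_reals all_analysis.
From mathcomp Require Import complex.

Set Implicit Arguments.
Unset Strict Implicit.
Unset Printing Implicit Defensive.

Import Order.TTheory GRing.Theory Num.Theory.
Import numFieldNormedType.Exports.

Local Open Scope classical_set_scope.
Local Open Scope ring_scope.
Local Open Scope complex_scope.

Section HermitianSpace.
Context (R : realType) (m : nat).
Implicit Types u v : 'rV[R[i]]_m.

(* The flat Kaehler metric of C^m is the real part of the Hermitian product. *)
Definition inner u v : R := complex.Re (\sum_k u 0 k * conjc (v 0 k)).
Definition norm2 u : R := Num.sqrt (inner u u).
Definition Jop u : 'rV[R[i]]_m := (0 +i* 1) *: u.

End HermitianSpace.

(* On an open set, f is of class C^oo iff all its iterated partial derivatives *)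
(* (f itself included) are differentiable.                                     *)
Definition iter_partial (R : realType) n (s : seq 'I_n) (f : 'rV[R]_n -> R) :
    'rV[R]_n -> R :=
  foldr (fun i h a => 'D_(delta_mx 0 i) h a) f s.

Definition smooth_on (R : realType) n (U : set 'rV[R]_n) (f : 'rV[R]_n -> R) :=
  forall (s : seq 'I_n) (a : 'rV[R]_n), U a -> differentiable (iter_partial s f) a.

(* A homeomorphism [coord] from the open set [dom] onto an open subset of R^n, *)
(* with inverse [param]; both functions are arbitrary outside these sets.      *)
Record chart (R : realType) (n : nat) (M : topologicalType) := Chart {
  dom : set M;
  coord : M -> 'rV[R]_n;
  param : 'rV[R]_n -> M;
  open_dom : open dom;
  open_cod : open (coord @` dom);
  coordK : forall p, dom p -> param (coord p) = p;
  continuous_coord : forall p, dom p -> {for p, continuous coord};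
  continuous_param : forall p, dom p -> {for coord p, continuous param}
}.

(* The atlas need not be maximal. *)
Record manifold (R : realType) (n : nat) := Manifold {
  points :> topologicalType;
  atlas : set (chart R n points);
  atlas_cover : forall p, exists2 c, atlas c & dom c p;
  atlas_smooth : forall c d, atlas c -> atlas d -> forall k,
    smooth_on (coord c @` (dom c `&` dom d)) (fun a => coord d (param c a) 0 k);
  hausdorff_points : hausdorff_space points;
  second_countable_points : @second_countable points
}.

Section Calculus.
Context (R : realType) (n m : nat) (M : manifold R n).
Implicit Types (c : chart R n M) (p : M) (i j : 'I_n).

Definition chart_at p : chart R n M := sval (cid2 (atlas_cover p)).

Definition smooth_in c (f : M -> R) :=
  smooth_on (coord c @` dom c) (f \o param c).

(* The functions below are meaningful at the points of [dom c]; vectors tangent *)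
(* to M there are represented by their components in the coordinate frame of c. *)
Definition partial c i (f : M -> R) (p : M) : R :=
  'D_(delta_mx 0 i) (f \o param c) (coord c p).

Definition cpartial c i (f : M -> 'rV[R[i]]_m) (p : M) : 'rV[R[i]]_m :=
  \row_k (partial c i (fun q => complex.Re (f q 0 k)) p
          +i* partial c i (fun q => complex.Im (f q 0 k)) p).

Definition dmap c (f : M -> 'rV[R[i]]_m) p (u : 'rV[R]_n) : 'rV[R[i]]_m :=
  \sum_i (u 0 i)%:C *: cpartial c i f p.

Definition smooth_map (f : M -> 'rV[R[i]]_m) := forall c, atlas c -> forall k,
  smooth_in c (fun q => complex.Re (f q 0 k)) /\
  smooth_in c (fun q => complex.Im (f q 0 k)).

Definition totally_real (f : M -> 'rV[R[i]]_m) :=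
  forall c p, atlas c -> dom c p -> forall u v : 'rV[R]_n,
    inner (Jop (dmap c f p u)) (dmap c f p v) = 0.

End Calculus.

(* [gmx g c p] is the matrix of the metric in the coordinate frame of c at p. *)
Record metric (R : realType) (n : nat) (M : manifold R n) := Metric {
  gmx : chart R n M -> M -> 'M[R]_n;
  gmx_smooth : forall c, atlas c -> forall i j, smooth_in c (fun p => gmx c p i j);
  gmx_sym : forall c p, atlas c -> dom c p -> (gmx c p)^T = gmx c p;
  gmx_pos : forall c p, atlas c -> dom c p -> forall u : 'rV[R]_n, u != 0 ->
    0 < (u *m gmx c p *m u^T) 0 0;
  gmx_tensor : forall c d p, atlas c -> atlas d -> dom c p -> dom d p ->
    let A := \matrix_(i, k) partial c i (fun q => coord d q 0 k) p in
    gmx c p = A *m gmx d p *m A^T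
}.

Section Riemannian.
Context (R : realType) (n m : nat) (M : manifold R n) (g : metric M).
Implicit Types (c : chart R n M) (p : M) (i j k l : 'I_n).

Definition ginv c p : 'M[R]_n := invmx (gmx g c p).

(* Gamma^k_ij for the Levi-Civita connection. *)
Definition christoffel c p i j k : R :=
  2^-1 * \sum_l ginv c p k l *
    (partial c i (fun q => gmx g c q j l) p
     + partial c j (fun q => gmx g c q i l) p
     - partial c l (fun q => gmx g c q i j) p).

Definition hessian c (f : M -> 'rV[R[i]]_m) p i j : 'rV[R[i]]_m :=
  cpartial c i (cpartial c j f) p
  - \sum_k (christoffel c p i j k)%:C *: cpartial c k f p.

(* Evaluated in one chosen chart around p: the trace of the Hessian does not   *)
(* depend on the chart.                                                        *)
Definition laplacian (f : M -> 'rV[R[i]]_m) p : 'rV[R[i]]_m :=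
  - \sum_i \sum_j (ginv (chart_at p) p i j)%:C *: hessian (chart_at p) f p i j.

Definition gradient c (f : M -> R) p : 'rV[R]_n :=
  (\row_i partial c i f p) *m ginv c p.

End Riemannian.

Section Immersion.
Context (R : realType) (n m : nat) (M : manifold R n) (g : metric M).
Context (x : M -> 'rV[R[i]]_m).
Implicit Types (c : chart R n M) (p : M) (i j : 'I_n) (w xi : 'rV[R[i]]_m).

Record isometric_immersion : Prop := IsometricImmersion {
  isometric_smooth : smooth_map x;
  isometric_immersive : forall c p, atlas c -> dom c p ->
    injective (dmap c x p);
  isometricP : forall c p, atlas c -> dom c p -> forall u v : 'rV[R]_n,
    (u *m gmx g c p *m v^T) 0 0 = inner (dmap c x p u) (dmap c x p v)
}.

(* Components of the tangent vector whose image under dx is the orthogonal     *)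
(* projection of w on dx(T_p M), when x is an isometric immersion.             *)
Definition tangent_part c p w : 'rV[R]_n :=
  (\row_j inner w (cpartial c j x p)) *m ginv g c p.

Definition normal_part c p w : 'rV[R[i]]_m := w - dmap c x p (tangent_part c p w).

Definition second_form c p i j : 'rV[R[i]]_m :=
  normal_part c p (cpartial c i (cpartial c j x) p).

(* The trace of the second fundamental form is independent of the chart too. *)
Definition mean_curvature p : 'rV[R[i]]_m :=
  (n%:R^-1)%:C *: \sum_i \sum_j
    (ginv g (chart_at p) p i j)%:C *: second_form (chart_at p) p i j.

Definition mean_curvature_fun p : R := norm2 (mean_curvature p).

Definition unit_mean_curvature p : 'rV[R[i]]_m :=
  ((mean_curvature_fun p)^-1)%:C *: mean_curvature p.

(* g(A_xi u, v) = <h(u, v), xi> *)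
Definition shape c p xi (u : 'rV[R]_n) : 'rV[R]_n :=
  u *m (\matrix_(i, j) inner (second_form c p i j) xi) *m ginv g c p.

(* The normal connection is the normal part of the flat connection of C^m. *)
Definition parallel_normal (xi : M -> 'rV[R[i]]_m) :=
  forall c p, atlas c -> dom c p -> forall u : 'rV[R]_n,
    normal_part c p (dmap c xi p u) = 0.

Definition parallel_normalized_mean_curvature :=
  (forall p, mean_curvature p != 0) /\ parallel_normal unit_mean_curvature.

Definition laplace_map : M -> 'rV[R[i]]_m := laplacian g x.

(* u is the tangent vector JH. *)
Definition shape_JH_parallel_gradient :=
  forall c p, atlas c -> dom c p ->
    exists u : 'rV[R]_n, dmap c x p u = Jop (mean_curvature p) /\
      ~~ free [:: shape c p (mean_curvature p) u;
                  gradient g c mean_curvature_fun p].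

End Immersion.

(* Main.v *)
(** By the Gauss formula the Hessian of an isometric immersion is its second
    fundamental form, so the Laplace map is [L = - n H] and only the differential
    of [H] matters.  If [H] is parallel, [dH] takes its values in the
    tangent spaces, on which [<J . , .>] vanishes.  If [xi = H / alpha] is
    parallel, then [dH(u) = dalpha(u) xi + alpha dxi(u)] with [dxi(u)] tangent and
    equal to [- A_xi u].  The terms [<J xi, xi>] and [<J dxi(u), dxi(v)>] vanish,
    and, [J H] being tangent when [m = n],
      [<J dH(u), dH(v)> = (dalpha(v) <A_H JH, u> - dalpha(u) <A_H JH, v>) / alpha],
    which vanishes for all [u, v] exactly when [A_H JH] and the gradient of [alpha]
    are linearly dependent. *)

From mathcomp Require Import all_boot all_order all_algebra.
From mathcomp Require Import all_classical all_reals all_analysis.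
From mathcomp Require Import complex ring lra.
(* Comes last so that [coord] is the chart map and not [vector.coord]. *)
Require Import Defs.

Set Implicit Arguments.
Unset Strict Implicit.
Unset Printing Implicit Defensive.

Import Order.TTheory GRing.Theory Num.Theory.
Import numFieldNormedType.Exports.

Local Open Scope classical_set_scope.
Local Open Scope ring_scope.
Local Open Scope complex_scope.

(** * Symmetry of mixed second derivatives *)

Section DifferentiableNormed.
Context (R : realType) (V W : normedModType R).

(** The first-order expansion at [a] sees only the germ of the function, so that of [f] also serves
    for [g]; uniqueness of the differential then identifies it. *)
Lemma near_eq_is_diff (f g : V -> W) a :
  (\forall b \near a, f b = g b) -> differentiable f a -> is_diff a g ('d f a).
Proof.
move=> fg df; have dfc := diff_continuous df.
have go : g \o shift a = cst (g a) + 'd f a +o_ 0 id.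
  have /diff_locally/eqaddoP fo := df; apply/eqaddoP => e /fo {}fo.
  have sh : (fun h : V => h + a) @ 0 --> a.
    by rewrite -[X in _ --> X]add0r; apply: cvgD; [exact: cvg_id|exact: cvg_cst].
  have {sh} fgs : \forall h \near 0, f (h + a) = g (h + a) by exact: (sh _ fg).
  apply: filterS2 fo fgs => h /= + fgh; rewrite !fctE /= fgh.
  by rewrite (nbhs_singleton fg).
apply: DiffDef; last exact: diff_unique.
by apply/diff_locallyP; rewrite (diff_unique dfc go).
Qed.

Lemma near_eq_differentiable (f g : V -> W) a :
  (\forall b \near a, f b = g b) -> differentiable f a -> differentiable g a.
Proof. by move=> fg /(near_eq_is_diff fg) []. Qed.

End DifferentiableNormed.

Section Schwarz.
Context (R : realType) (V : normedModType R).
Implicit Types (f : V -> R) (a u v : V).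

Lemma is_derive_line f a b u : differentiable f (a + b *: u) ->
  is_derive b 1 (fun t : R => f (a + t *: u)) ('D_u f (a + b *: u)).
Proof.
move=> df; pose l (t : R) := a + t *: u.
have dl : is_diff b l (fun t : R => t *: u).
  rewrite [X in is_diff _ X _](_ : _ = cst a + (fun t : R => t *: u)) //.
  by rewrite -[X in is_diff _ _ X]add0r; apply: is_diffD.
have D : differentiable (f \o l) b by apply: differentiable_comp => //; exact: ex_diff.
apply: (@DeriveDef _ _ _ _ _ (f \o l)); first exact: diff_derivable.
rewrite deriveE // diff_comp //.
by rewrite /= diff_val scale1r deriveE.
Qed.

Let second_difference f a u v h :=
  f (a + h *: v + h *: u) - f (a + h *: u) - (f (a + h *: v) - f a).

(** By the mean value theorem along [u], the second difference is [h] times a difference of two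
    values of ['D_u f], which differentiability of ['D_u f] at [a] evaluates up to o(h). *)
Lemma second_difference_approx f a u v :
  (\forall b \near a, differentiable f b) -> differentiable ('D_u f) a ->
  forall e, 0 < e -> \forall h \near 0^'+,
    `|second_difference f a u v h - h ^+ 2 * 'D_v ('D_u f) a| <= e * h ^+ 2.
Proof.
move=> df dDf e e0.
(* [K] bounds the norm of [h *: v + t *: u] by [h * K] for [0 <= t <= h]; the summand 1 keeps it
   positive when [u] and [v] vanish. Two linearisation errors of size [e / (2 * K) * (h * K)] then
   add up to [e * h]. *)
pose K := 2 * `|u| + `|v| + 1.
have K0 : 0 < K by rewrite /K; have := normr_ge0 u; have := normr_ge0 v; lra.
have e'0 : 0 < e / (2 * K) by rewrite divr_gt0 // mulr_gt0.
have /diff_locally/eqaddoP/(_ _ e'0) /nbhs_ballP [d1 /= d10 B1] := dDf.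
have /nbhs_ballP [d2 /= d20 B2] := df.
pose d := Num.min d1 d2.
have d0 : 0 < d by rewrite /d lt_min d10.
near=> h.
have h0 : 0 < h by [].
have hd : h * K < d.
  by rewrite -ltr_pdivlMr //; near: h; apply: nbhs_right_lt; rewrite divr_gt0.
have bound t w : 0 <= t <= h -> w = 0 \/ w = v -> `|h *: w + t *: u| <= h * K.
  move=> /andP[t0 th] wv; apply: (le_trans (ler_normD _ _)).
  rewrite !normrZ (ger0_norm t0) (gtr0_norm h0) /K.
  have w0 : `|w| <= `|v| by case: wv => -> //; rewrite normr0.
  have := ler_wpM2r (normr_ge0 u) th.
  have := ler_wpM2l (ltW h0) w0.
  by have := normr_ge0 u; nra.
have diff_near t w : 0 <= t <= h -> w = 0 \/ w = v ->
    differentiable f (a + h *: w + t *: u).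
  move=> th wv; apply: B2; rewrite -ball_normE /=.
  rewrite -addrA opprD addrA subrr sub0r normrN.
  apply: (le_lt_trans (bound _ _ th wv)).
  by rewrite (lt_le_trans hd) // /d ge_min lexx orbT.
have derive_near t w : 0 <= t <= h -> w = 0 \/ w = v ->
    `|'D_u f (a + h *: w + t *: u) - ('D_u f a + 'd ('D_u f) a (h *: w + t *: u))|
      <= e / (2 * K) * (h * K).
  move=> th wv; have b := bound _ _ th wv.
  have := B1 (h *: w + t *: u); rewrite -ball_normE /= sub0r normrN.
  have b1 : `|h *: w + t *: u| < d1.
    by rewrite (le_lt_trans b) // (lt_le_trans hd) // /d ge_min lexx.
  move=> /(_ b1); rewrite !fctE /= [_ + a]addrC addrA => /le_trans; apply.
  by rewrite ler_wpM2l // ltW.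
(* The second difference is the increment of [phi] over [0, h]. *)
pose phi t := f (a + h *: v + t *: u) - f (a + h *: 0 + t *: u).
have dphi t : 0 <= t <= h -> is_derive t 1 phi
    ('D_u f (a + h *: v + t *: u) - 'D_u f (a + h *: 0 + t *: u)).
  by move=> th; apply: is_deriveB; apply: is_derive_line; apply: diff_near; auto.
have cphi : {within `[0, h], continuous phi}.
  apply/continuous_in_subspaceT => t; rewrite inE /= in_itv /= => th.
  apply: differentiable_continuous; apply/derivable1_diffP.
  by case: (dphi _ th).
have dphi_itv t : t \in `]0, h[ -> is_derive t 1 phi
    ('D_u f (a + h *: v + t *: u) - 'D_u f (a + h *: 0 + t *: u)).
  by rewrite in_itv /= => /andP[t0 th]; apply: dphi; rewrite !ltW.
have [t] := MVT h0 dphi_itv cphi.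
rewrite in_itv /= subr0 => /andP[t0 th] E.
have {t0} th : 0 <= t <= h by rewrite !ltW.
have -> : second_difference f a u v h = phi h - phi 0.
  by rewrite /phi /second_difference !scaler0 !scale0r !addr0; ring.
have D1 := derive_near t v th (or_intror erefl).
have D2 := derive_near t 0 th (or_introl erefl).
rewrite ['d _ _ (_ + _)]linearD ['d _ _ (h *: v)]linearZ in D1.
rewrite ['d _ _ (t *: u)]linearZ /= in D1.
rewrite !(scaler0, addr0, add0r) ['d _ _ (t *: u)]linearZ /= in D2.
rewrite {}E ['D_v _ a]deriveE // !(scaler0, addr0); move: D1 D2.
set x1 := 'D_u f (a + _ + _); set x0 := 'D_u f (a + _); set y := 'D_u f a.
set z := 'd _ _ v; set z' := 'd _ _ u => D1 D2.
have Ee : e / (2 * K) * (h * K) = e * h / 2 by field; lra.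
rewrite Ee in D1 D2.
(* The two linearisations share the term [t *: z'] and differ by [h *: z], so only their errors
   remain. *)
have -> : (x1 - x0) * h - h ^+ 2 * z =
    h * ((x1 - (y + (h *: z + t *: z'))) - (x0 - (y + t *: z'))).
  by rewrite /GRing.scale /=; ring.
rewrite normrM (gtr0_norm h0) (_ : e * h ^+ 2 = h * (e * h)); last by ring.
rewrite ler_wpM2l ?(ltW h0) //; apply: (le_trans (ler_normB _ _)).
by rewrite [leRHS](_ : _ = e * h / 2 + e * h / 2) ?lerD //; field.
Unshelve. all: by end_near. Qed.

(** The second difference is symmetric in [u] and [v]; divided by [h ^+ 2], it approximates both
    mixed derivatives. *)
Lemma derive_commute f a u v : (\forall b \near a, differentiable f b) ->
  differentiable ('D_u f) a -> differentiable ('D_v f) a ->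
  'D_v ('D_u f) a = 'D_u ('D_v f) a.
Proof.
move=> df du dv; apply/eqP; rewrite -subr_eq0 -normr_le0.
apply/ler_addgt0Pl => e e0; rewrite addr0.
have e20 : 0 < e / 2 by lra.
have [h [[H1 H2] h0]] := filter_ex (filterI (filterI
  (second_difference_approx v df du e20) (second_difference_approx u df dv e20))
  (nbhs_right_gt (0 : R))).
rewrite -(ler_pM2l (exprn_gt0 2 h0)).
have E : second_difference f a v u h = second_difference f a u v h.
  by rewrite /second_difference (addrAC a (h *: u)); ring.
move: H1 H2; rewrite {}E; set S := second_difference _ _ _ _ _.
set x := 'D_v _ a; set y := 'D_u _ a => H1 H2.
have -> : h ^+ 2 * e = e / 2 * h ^+ 2 + e / 2 * h ^+ 2 by field.
rewrite -[X in X * _](gtr0_norm (exprn_gt0 2 h0)) -normrM.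
apply: le_trans (lerD H2 H1); apply: le_trans (ler_normB _ _).
by rewrite (_ : h ^+ 2 * (x - y) = (S - h ^+ 2 * y) - (S - h ^+ 2 * x)) //; ring.
Qed.

End Schwarz.

(** * Differentiation in charts *)

Section ChartCalculus.
Context (R : realType) (n : nat) (M : manifold R n).
Implicit Types (c d : chart R n M) (p q : M) (f h : M -> R) (i j k : 'I_n).

Definition diff_in c f p := differentiable (f \o param c) (coord c p).

Lemma near_dom c p : dom c p -> \forall q \near p, dom c q.
Proof. by move=> cp; apply: open_nbhs_nbhs; split => //; exact: open_dom. Qed.

Lemma near_cod c p : dom c p -> \forall a \near coord c p, (coord c @` dom c) a.
Proof. by move=> cp; apply: open_nbhs_nbhs; split; [exact: open_cod|exists p]. Qed.

Lemma near_param c p (P : M -> Prop) : dom c p -> (\forall q \near p, P q) ->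
  \forall a \near coord c p, P (param c a).
Proof.
move=> cp nP; have : param c @ coord c p --> p.
  by rewrite -[X in _ --> X](coordK cp); exact: continuous_param.
exact.
Qed.

Lemma near_eq_partial c p f h i : dom c p -> (\forall q \near p, f q = h q) ->
  partial c i f p = partial c i h p.
Proof. by move=> cp /(near_param cp) fh; exact: (near_eq_derive _ fh). Qed.

Lemma near_eq_diff_in c p f h : dom c p -> (\forall q \near p, f q = h q) ->
  diff_in c f p -> diff_in c h p.
Proof. by move=> cp /(near_param cp) fh; exact: near_eq_differentiable fh. Qed.

(** Lets iterated chart derivatives be read as iterated directional derivatives in R^n. The
    restriction on [a] ensures that [coord c (param c a)] is [a]. *)
Lemma partial_param c i f : forall a, (coord c @` dom c) a ->
  (partial c i f \o param c) a = 'D_(delta_mx 0 i) (f \o param c) a.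
Proof. by move=> _ [p cp <-]; rewrite /= coordK. Qed.

(** As [U] is open, agreement on [U] is agreement of germs and passes to each further partial
    derivative. *)
Lemma smooth_on_eq (U : set 'rV[R]_n) (F G : 'rV[R]_n -> R) : open U ->
  (forall a, U a -> F a = G a) -> smooth_on U F -> smooth_on U G.
Proof.
move=> oU FG sF s.
have E : forall a, U a -> iter_partial s F a = iter_partial s G a.
  rewrite /iter_partial; elim: s => [|i s IH] a Ua /=; first exact: FG.
  apply: near_eq_derive.
  by apply: filterS IH _; apply: open_nbhs_nbhs.
move=> a Ua; apply: (near_eq_differentiable _ (sF s a Ua)).
by apply: filterS E _; apply: open_nbhs_nbhs.
Qed.

Lemma smooth_in_partial c i f : smooth_in c f -> smooth_in c (partial c i f).
Proof.
move=> sf; apply: (@smooth_on_eq _ ('D_(delta_mx 0 i) (f \o param c))).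
- exact: open_cod.
- by move=> a /partial_param <-.
(* [foldr] applies the last index first, so the derivative already taken goes to the end of the
   sequence. *)
- by move=> s a /(sf (rcons s i) a); rewrite /iter_partial foldr_rcons.
Qed.

Lemma smooth_in_diff c f p : smooth_in c f -> dom c p -> diff_in c f p.
Proof. by move=> sf cp; apply: (sf [::]); exists p. Qed.

Lemma partial_commute c i j f p : smooth_in c f -> dom c p ->
  partial c i (partial c j f) p = partial c j (partial c i f) p.
Proof.
move=> sf cp.
have E k l : partial c k (partial c l f) p =
    'D_(delta_mx 0 k) ('D_(delta_mx 0 l) (f \o param c)) (coord c p).
  by apply: near_eq_derive; apply: filterS (@partial_param c l f) (near_cod cp).
rewrite !E; apply: derive_commute.
- by apply: filterS (sf [::]) (near_cod cp).
- by apply: (sf [:: j]); exists p.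
- by apply: (sf [:: i]); exists p.
Qed.

Lemma diff_in_cst c p (r : R) : diff_in c (fun=> r) p.
Proof. exact: differentiable_cst. Qed.

Lemma diff_inD c p f h : diff_in c f p -> diff_in c h p ->
  diff_in c (fun q => f q + h q) p.
Proof. exact: differentiableD. Qed.

Lemma diff_inN c p f : diff_in c f p -> diff_in c (fun q => - f q) p.
Proof. exact: differentiableN. Qed.

Lemma diff_inM c p f h : diff_in c f p -> diff_in c h p ->
  diff_in c (fun q => f q * h q) p.
Proof. exact: differentiableM. Qed.

Lemma diff_inV c p f : f p != 0 -> dom c p -> diff_in c f p ->
  diff_in c (fun q => (f q)^-1) p.
Proof. by move=> f0 cp df; apply: differentiableV => //=; rewrite coordK. Qed.

Lemma diff_in_sqrt c p f : 0 < f p -> dom c p -> diff_in c f p ->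
  diff_in c (fun q => Num.sqrt (f q)) p.
Proof.
move=> f0 cp df; apply: (@differentiable_comp _ _ _ _ (f \o param c) Num.sqrt) => //.
apply/derivable1_diffP; rewrite /= coordK //.
by have [] := is_derive1_sqrt f0.
Qed.

Lemma diff_in_sum c p (I : Type) (r : seq I) (P : pred I) (F : I -> M -> R) :
  (forall a, diff_in c (F a) p) ->
  diff_in c (fun q => \sum_(a <- r | P a) F a q) p.
Proof.
move=> dF; elim: r => [|a r IH].
  by under eq_fun do rewrite big_nil; exact: diff_in_cst.
under eq_fun do rewrite big_cons; case: (P a) => //.
exact: diff_inD.
Qed.

Lemma diff_in_prod c p (I : Type) (r : seq I) (P : pred I) (F : I -> M -> R) :
  (forall a, diff_in c (F a) p) ->
  diff_in c (fun q => \prod_(a <- r | P a) F a q) p.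
Proof.
move=> dF; elim: r => [|a r IH].
  by under eq_fun do rewrite big_nil; exact: diff_in_cst.
under eq_fun do rewrite big_cons; case: (P a) => //.
exact: diff_inM.
Qed.

Lemma partialD c p f h i : diff_in c f p -> diff_in c h p ->
  partial c i (fun q => f q + h q) p = partial c i f p + partial c i h p.
Proof. by move=> df dh; apply: deriveD; exact: diff_derivable. Qed.

Lemma partial_cst c p (r : R) i : partial c i (fun=> r) p = 0.
Proof. exact: derive_cst. Qed.

Lemma partialM c p f h i : dom c p -> diff_in c f p -> diff_in c h p ->
  partial c i (fun q => f q * h q) p = partial c i f p * h p + f p * partial c i h p.
Proof.
move=> cp df dh; rewrite /partial.
rewrite [LHS](deriveM (f := f \o param c) (g := h \o param c)); [|exact: diff_derivable..].
by rewrite /= coordK // addrC; congr (_ + _); exact: mulrC.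
Qed.

Lemma partial_sum c p (I : Type) (r : seq I) (F : I -> M -> R) i :
  (forall a, diff_in c (F a) p) ->
  partial c i (fun q => \sum_(a <- r) F a q) p = \sum_(a <- r) partial c i (F a) p.
Proof.
move=> dF; elim: r => [|a r IH].
  by under eq_fun do rewrite big_nil; rewrite partial_cst big_nil.
under eq_fun do rewrite big_cons; rewrite partialD ?IH ?big_cons //.
exact: diff_in_sum.
Qed.

Lemma diff_in_det c p (m : nat) (A : M -> 'M[R]_m) :
  (forall k l : 'I_m, diff_in c (fun q => A q k l) p) -> diff_in c (fun q => \det (A q)) p.
Proof.
move=> dA; apply: diff_in_sum => s.
by apply: diff_inM; [exact: diff_in_cst|exact: diff_in_prod].
Qed.

(** Cramer's rule writes the entries of the inverse as rational functions of those of [A]; [invmx]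
    follows this formula where [A] is invertible, hence near [p]. *)
Lemma diff_in_invmx c p (m : nat) (A : M -> 'M[R]_m) (k l : 'I_m) : dom c p ->
  (forall q, dom c q -> A q \in unitmx) ->
  (forall k l : 'I_m, diff_in c (fun q => A q k l) p) ->
  diff_in c (fun q => invmx (A q) k l) p.
Proof.
move=> cp uA dA.
apply: (@near_eq_diff_in c p (fun q => (\det (A q))^-1 * \adj (A q) k l)) => //.
  by near=> q; rewrite /invmx uA ?mxE //; near: q; exact: near_dom.
apply: diff_inM.
  by apply: diff_inV => //; [rewrite -unitfE; exact: uA|exact: diff_in_det].
under eq_fun do rewrite mxE /cofactor.
apply: diff_inM; first exact: diff_in_cst.
apply: diff_in_det => k' l'; under eq_fun do rewrite !mxE.
exact: dA.
Unshelve. all: by end_near. Qed.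

(** * Change of charts *)

Section Transition.
Variables (c d : chart R n M) (p : M).
Hypotheses (ac : atlas c) (ad : atlas d) (cp : dom c p) (dp : dom d p).

Let overlap : (coord c @` (dom c `&` dom d)) (coord c p).
Proof. by exists p. Qed.

Lemma diff_in_coord k : diff_in c (fun q => coord d q 0 k) p.
Proof. by have S := atlas_smooth ac ad k; exact: (S [::] _ overlap). Qed.

Lemma diff_in_partial_coord i k : diff_in c (partial c i (fun q => coord d q 0 k)) p.
Proof.
have S := atlas_smooth ac ad k.
apply: (near_eq_differentiable _ (S [:: i] _ overlap)).
by apply: filterS (near_cod cp) => a /partial_param.
Qed.

Let phi (a : 'rV[R]_n) := coord d (param c a).

(** The atlas gives smoothness component by component; this sum turns it into differentiability of
    the vector-valued transition map. *)
Let phiE : phi = \sum_(k < n) (fun a => phi a 0 k *: delta_mx 0 k).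
Proof. by apply/funext => a; rewrite fct_sumE [LHS]row_sum_delta. Qed.

Let diff_phi : differentiable phi (coord c p).
Proof.
rewrite phiE; apply: differentiable_sum => k; apply: differentiableZl.
exact: diff_in_coord.
Qed.

Variable f : M -> R.
Hypothesis df : diff_in d f p.

(** The factorization through [phi] is only local, since [param d] inverts [coord d] on [dom d]. *)
Let local_eq : \forall a \near coord c p, ((f \o param d) \o phi) a = (f \o param c) a.
Proof.
apply: (near_param cp (P := fun q => f (param d (coord d q)) = f q)).
by apply: filterS (near_dom dp) => q dq; rewrite coordK.
Qed.

Let df' : differentiable (f \o param d) (phi (coord c p)).
Proof. by rewrite /phi coordK. Qed.

Lemma diff_in_transition : diff_in c f p.
Proof. by apply: (near_eq_differentiable local_eq); exact: differentiable_comp. Qed.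

Lemma partial_transition i : partial c i f p =
  \sum_k partial c i (fun q => coord d q 0 k) p * partial d k f p.
Proof.
have dphiE : 'd phi (coord c p) (delta_mx 0 i) =
    \sum_k partial c i (fun q => coord d q 0 k) p *: delta_mx 0 k.
  rewrite -deriveE // derive_mx; last exact: diff_derivable.
  by rewrite [LHS]row_sum_delta; apply: eq_bigr => k _; rewrite mxE.
rewrite {1}/partial -(near_eq_derive _ local_eq) deriveE; last exact: differentiable_comp.
rewrite diff_comp //= dphiE linear_sum /=; apply: eq_bigr => k _.
rewrite linearZ /=; congr (_ * _); rewrite -deriveE //.
by rewrite /phi coordK.
Qed.

End Transition.

End ChartCalculus.

(** * The Hermitian space C^m *)

Section HermitianAlgebra.
Context (R : realType) (m : nat).
Implicit Types (u v w : 'rV[R[i]]_m) (a : R) (t : bool * 'I_m).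

(* The 2m real coordinates of C^m: [(true, k)] is the real part of the k-th *)
(* component and [(false, k)] its imaginary part.                           *)
Definition rcoord t u : R :=
  if t.1 then complex.Re (u 0 t.2) else complex.Im (u 0 t.2).

Lemma rcoord_inj u v : (forall t, rcoord t u = rcoord t v) -> u = v.
Proof.
move=> uv; apply/rowP => k; have := uv (true, k); have := uv (false, k).
by rewrite /rcoord /=; case: (u 0 k) => a b; case: (v 0 k) => a' b' /= -> ->.
Qed.

Lemma rcoordD t u v : rcoord t (u + v) = rcoord t u + rcoord t v.
Proof. by rewrite /rcoord mxE; case: (u 0 _) (v 0 _) => [? ?] [? ?]; case: t.1. Qed.

Lemma rcoordZ t a u : rcoord t (a%:C *: u) = a * rcoord t u.
Proof.
rewrite /rcoord mxE; case: (u 0 _) => [y z] /=.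
by case: t.1; rewrite /= !mul0r ?subr0 ?addr0.
Qed.

Lemma rcoord0 t : rcoord t 0 = 0.
Proof. by rewrite /rcoord mxE; case: t.1. Qed.

Lemma rcoord_sum t (I : Type) (r : seq I) (F : I -> 'rV[R[i]]_m) :
  rcoord t (\sum_(b <- r) F b) = \sum_(b <- r) rcoord t (F b).
Proof. by elim/big_ind2: _ => [|x1 x2 y1 y2 <- <-|//]; rewrite ?rcoord0 ?rcoordD. Qed.

Lemma rcoordN t u : rcoord t (- u) = - rcoord t u.
Proof. by rewrite /rcoord mxE; case: (u 0 _) => [? ?]; case: t.1. Qed.

(** Identifies C^m with Euclidean R^(2m), so that real bilinearity and the product rule follow
    coordinatewise. *)
Lemma innerE u v : inner u v = \sum_t rcoord t u * rcoord t v.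
Proof.
rewrite -(pair_bigA _ (fun s k => rcoord (s, k) u * rcoord (s, k) v)) /=.
rewrite big_bool /= -big_split /= /inner (raddf_sum (@complex.Re R : {additive _ -> _})).
apply: eq_bigr => k _; rewrite /rcoord /=.
by case: (u 0 k) (v 0 k) => [a b] [a' b'] /=; rewrite mulrN opprK.
Qed.

Lemma innerC u v : inner u v = inner v u.
Proof. by rewrite !innerE; apply: eq_bigr => t _; rewrite mulrC. Qed.

Lemma innerDl u v w : inner (u + v) w = inner u w + inner v w.
Proof.
by rewrite !innerE -big_split; apply: eq_bigr => t _; rewrite rcoordD mulrDl.
Qed.

Lemma innerZl a u v : inner (a%:C *: u) v = a * inner u v.
Proof.
by rewrite !innerE mulr_sumr; apply: eq_bigr => t _; rewrite rcoordZ mulrA.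
Qed.

Lemma innerNl u v : inner (- u) v = - inner u v.
Proof.
by rewrite !innerE -sumrN; apply: eq_bigr => t _; rewrite rcoordN mulNr.
Qed.

Lemma inner0l v : inner 0 v = 0.
Proof. by rewrite innerE big1 // => t _; rewrite rcoord0 mul0r. Qed.

Lemma inner_suml (I : Type) (r : seq I) (F : I -> 'rV[R[i]]_m) v :
  inner (\sum_(b <- r) F b) v = \sum_(b <- r) inner (F b) v.
Proof.
by elim/big_ind2: _ => [|x1 x2 y1 y2 <- <-|//]; rewrite ?inner0l ?innerDl.
Qed.

Lemma innerDr u v w : inner w (u + v) = inner w u + inner w v.
Proof. by rewrite !(innerC w) innerDl. Qed.

Lemma innerZr a u v : inner u (a%:C *: v) = a * inner u v.
Proof. by rewrite !(innerC u) innerZl. Qed.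

Lemma inner_sumr (I : Type) (r : seq I) (F : I -> 'rV[R[i]]_m) v :
  inner v (\sum_(b <- r) F b) = \sum_(b <- r) inner v (F b).
Proof. by rewrite innerC inner_suml; apply: eq_bigr => b _; rewrite innerC. Qed.

Lemma inner_gt0 u : u != 0 -> 0 < inner u u.
Proof.
move=> u0; rewrite lt_def innerE; apply/andP; split; last first.
  by apply: sumr_ge0 => t _; rewrite -expr2 sqr_ge0.
apply: contra u0 => /eqP s0; apply/eqP/rcoord_inj => t; rewrite rcoord0.
have sq0 t' : true -> 0 <= rcoord t' u * rcoord t' u by rewrite -expr2 sqr_ge0.
by have /(_ t isT)/eqP := psumr_eq0P sq0 s0; rewrite mulf_eq0 orbb => /eqP.
Qed.

Lemma JopD u v : Jop (u + v) = Jop u + Jop v.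
Proof. exact: scalerDr. Qed.

Lemma JopZ a u : Jop (a%:C *: u) = a%:C *: Jop u.
Proof. by rewrite /Jop !scalerA mulrC. Qed.

Lemma Jop_sum (I : Type) (r : seq I) (F : I -> 'rV[R[i]]_m) :
  Jop (\sum_(b <- r) F b) = \sum_(b <- r) Jop (F b).
Proof. exact: scaler_sumr. Qed.

(** Skew-symmetry of the Kaehler form, checked on each complex component. *)
Lemma inner_Jop u v : inner (Jop u) v = - inner (Jop v) u.
Proof.
rewrite /inner -raddfN -sumrN !(raddf_sum (@complex.Re R : {additive _ -> _})).
apply: eq_bigr => k _; rewrite !mxE.
by case: (u 0 k) (v 0 k) => [a b] [a' b'] /=; ring.
Qed.

Lemma inner_Jop_self u : inner (Jop u) u = 0.
Proof. by have := inner_Jop u u; lra. Qed.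

End HermitianAlgebra.

(** * Calculus of C^m-valued functions in charts *)

Section VectorCalculus.
Context (R : realType) (n m : nat) (M : manifold R n).
Implicit Types (c d : chart R n M) (p q : M) (f h : M -> 'rV[R[i]]_m).
Implicit Types (a : M -> R) (i j k : 'I_n).

Definition cdiff_in c f p := forall t, diff_in c (fun q => rcoord t (f q)) p.

Lemma rcoord_cpartial t c i f p :
  rcoord t (cpartial c i f p) = partial c i (fun q => rcoord t (f q)) p.
Proof. by rewrite /rcoord mxE; case: t.1. Qed.

Lemma smooth_map_rcoord f c t : smooth_map f -> atlas c ->
  smooth_in c (fun q => rcoord t (f q)).
Proof. by move=> sf ac; case: t => -[] k; have [] := sf c ac k. Qed.

Lemma near_eq_cpartial c p f h i : dom c p -> (\forall q \near p, f q = h q) ->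
  cpartial c i f p = cpartial c i h p.
Proof.
move=> cp fh; apply: rcoord_inj => t; rewrite !rcoord_cpartial.
by apply: near_eq_partial => //; apply: filterS fh => q ->.
Qed.

Lemma near_eq_cdiff_in c p f h : dom c p -> (\forall q \near p, f q = h q) ->
  cdiff_in c f p -> cdiff_in c h p.
Proof.
move=> cp fh df t; apply: near_eq_diff_in cp _ (df t).
by apply: filterS fh => q ->.
Qed.

Lemma cdiff_inD c p f h : cdiff_in c f p -> cdiff_in c h p ->
  cdiff_in c (fun q => f q + h q) p.
Proof. by move=> df dh t; under eq_fun do rewrite rcoordD; exact: diff_inD. Qed.

Lemma cdiff_inN c p f : cdiff_in c f p -> cdiff_in c (fun q => - f q) p.
Proof. by move=> df t; under eq_fun do rewrite rcoordN; exact: diff_inN. Qed.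

Lemma cdiff_inZ c p a f : diff_in c a p -> cdiff_in c f p ->
  cdiff_in c (fun q => (a q)%:C *: f q) p.
Proof. by move=> da df t; under eq_fun do rewrite rcoordZ; exact: diff_inM. Qed.

Lemma cdiff_in_sum c p (I : Type) (r : seq I) (F : I -> M -> 'rV[R[i]]_m) :
  (forall b, cdiff_in c (F b) p) -> cdiff_in c (fun q => \sum_(b <- r) F b q) p.
Proof.
by move=> dF t; under eq_fun do rewrite rcoord_sum; apply: diff_in_sum => b; exact: dF.
Qed.

Lemma diff_in_inner c p f h : cdiff_in c f p -> cdiff_in c h p ->
  diff_in c (fun q => inner (f q) (h q)) p.
Proof.
move=> df dh; under eq_fun do rewrite innerE.
by apply: diff_in_sum => t; exact: diff_inM.
Qed.

Lemma cpartialZ c p a f i : dom c p -> diff_in c a p -> cdiff_in c f p ->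
  cpartial c i (fun q => (a q)%:C *: f q) p =
  (partial c i a p)%:C *: f p + (a p)%:C *: cpartial c i f p.
Proof.
move=> cp da df; apply: rcoord_inj => t.
rewrite rcoordD !rcoordZ !rcoord_cpartial -partialM //.
by congr (partial _ _ _ _); apply/funext => q; rewrite rcoordZ.
Qed.

Lemma cpartial_sum c p (I : Type) (r : seq I) (F : I -> M -> 'rV[R[i]]_m) i :
  (forall b, cdiff_in c (F b) p) ->
  cpartial c i (fun q => \sum_(b <- r) F b q) p = \sum_(b <- r) cpartial c i (F b) p.
Proof.
move=> dF; apply: rcoord_inj => t; rewrite rcoord_sum rcoord_cpartial.
under eq_fun do rewrite rcoord_sum.
rewrite partial_sum => [|b]; last exact: dF.
by apply: eq_bigr => b _; rewrite rcoord_cpartial.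
Qed.

Lemma partial_inner c p f h i : dom c p -> cdiff_in c f p -> cdiff_in c h p ->
  partial c i (fun q => inner (f q) (h q)) p =
  inner (cpartial c i f p) (h p) + inner (f p) (cpartial c i h p).
Proof.
move=> cp df dh; under eq_fun do rewrite innerE.
rewrite partial_sum => [|t]; last exact: diff_inM.
rewrite !innerE -big_split; apply: eq_bigr => t _.
by rewrite partialM // !rcoord_cpartial.
Qed.

Lemma cdiff_in_transition c d p f : atlas c -> atlas d -> dom c p -> dom d p ->
  cdiff_in d f p -> cdiff_in c f p.
Proof. by move=> ac ad cp dp df t; exact: diff_in_transition (df t). Qed.

Lemma cpartial_transition c d p f i : atlas c -> atlas d -> dom c p -> dom d p ->
  cdiff_in d f p -> cpartial c i f p =
  \sum_k (partial c i (fun q => coord d q 0 k) p)%:C *: cpartial d k f p.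
Proof.
move=> ac ad cp dp df; apply: rcoord_inj => t; rewrite rcoord_sum rcoord_cpartial.
rewrite (partial_transition ac ad cp dp (df t)).
by apply: eq_bigr => k _; rewrite rcoordZ rcoord_cpartial.
Qed.

Section Smooth.
Variables (c : chart R n M) (f : M -> 'rV[R[i]]_m).
Hypotheses (ac : atlas c) (sf : smooth_map f).

Lemma smooth_cdiff p : dom c p -> cdiff_in c f p.
Proof. by move=> cp t; apply: smooth_in_diff => //; exact: smooth_map_rcoord. Qed.

Lemma smooth_cdiff_partial p i : dom c p -> cdiff_in c (cpartial c i f) p.
Proof.
move=> cp t; under eq_fun do rewrite rcoord_cpartial.
by apply: smooth_in_diff => //; apply: smooth_in_partial; exact: smooth_map_rcoord.
Qed.

(** Third-order regularity, which will make the second fundamental form, and so [H],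
    differentiable. *)
Lemma smooth_cdiff_partial2 p i j : dom c p ->
  cdiff_in c (cpartial c i (cpartial c j f)) p.
Proof.
move=> cp t; under eq_fun do rewrite rcoord_cpartial.
apply: smooth_in_diff => //; apply: smooth_in_partial.
under eq_fun do rewrite rcoord_cpartial.
by apply: smooth_in_partial; exact: smooth_map_rcoord.
Qed.

Lemma cpartial_commute p i j : dom c p ->
  cpartial c i (cpartial c j f) p = cpartial c j (cpartial c i f) p.
Proof.
move=> cp; apply: rcoord_inj => t.
have E k l : rcoord t (cpartial c k (cpartial c l f) p) =
    partial c k (partial c l (fun q => rcoord t (f q))) p.
  rewrite rcoord_cpartial; congr (partial _ _ _ _).
  by apply/funext => q; rewrite rcoord_cpartial.
rewrite [LHS]E [RHS]E; apply: partial_commute => //; exact: smooth_map_rcoord.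
Qed.

End Smooth.

End VectorCalculus.

(** * The second fundamental form *)

Section ChartGeometry.
Context (R : realType) (n m : nat) (M : manifold R n) (g : metric M).
Context (x : M -> 'rV[R[i]]_m).
Hypothesis isox : isometric_immersion g x.
Implicit Types (c d : chart R n M) (p q : M) (w : 'rV[R[i]]_m) (i j k l : 'I_n).
Implicit Types (u v : 'rV[R]_n).

Let smx : smooth_map x := isometric_smooth isox.

Lemma dmap_delta c (f : M -> 'rV[R[i]]_m) p i :
  dmap c f p (delta_mx 0 i) = cpartial c i f p.
Proof.
rewrite /dmap (bigD1 i) //= mxE !eqxx scale1r big1 ?addr0 // => j ji.
by rewrite mxE (negbTE ji) andbF scale0r.
Qed.

Lemma inner_dmapl c (f : M -> 'rV[R[i]]_m) p u w :
  inner (dmap c f p u) w = \sum_i u 0 i * inner (cpartial c i f p) w.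
Proof. by rewrite inner_suml; apply: eq_bigr => i _; rewrite innerZl. Qed.

Lemma dmapD c (f : M -> 'rV[R[i]]_m) p u v :
  dmap c f p (u + v) = dmap c f p u + dmap c f p v.
Proof.
rewrite /dmap -big_split; apply: eq_bigr => i _.
by rewrite mxE rmorphD scalerDl.
Qed.

Lemma dmapZ c (f : M -> 'rV[R[i]]_m) p (a : R) u :
  dmap c f p (a *: u) = a%:C *: dmap c f p u.
Proof.
rewrite /dmap scaler_sumr; apply: eq_bigr => i _.
by rewrite mxE rmorphM scalerA.
Qed.

Lemma dmap0 c (f : M -> 'rV[R[i]]_m) p : dmap c f p 0 = 0.
Proof. by rewrite /dmap big1 // => i _; rewrite mxE scale0r. Qed.

Section AtPoint.
Variables (c : chart R n M) (p : M).
Hypotheses (ac : atlas c) (cp : dom c p).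

Local Notation e i := (cpartial c i x p).

Lemma gmxE i j : gmx g c p i j = inner (e i) (e j).
Proof.
by rewrite -!dmap_delta -(isometricP isox ac cp) trmx_delta -rowE -colE !mxE.
Qed.

(** A nonzero kernel vector would have zero length, against positivity of the metric. *)
Lemma gmx_unit : gmx g c p \in unitmx.
Proof.
rewrite -row_free_unit -kermx_eq0; apply/rowV0P => v /sub_kermxP vG0.
apply: contraTeq isT => v0; have := gmx_pos g ac cp v0.
by rewrite vG0 mul0mx mxE ltxx.
Qed.

Lemma ginv_sym : (ginv g c p)^T = ginv g c p.
Proof. by rewrite /ginv trmx_inv (gmx_sym g ac cp). Qed.

Lemma inner_dmap u j : inner (dmap c x p u) (e j) = (u *m gmx g c p) 0 j.
Proof. by rewrite inner_dmapl mxE; apply: eq_bigr => i _; rewrite gmxE. Qed.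

Lemma normal_part_orth w j : inner (normal_part g x c p w) (e j) = 0.
Proof.
rewrite /normal_part innerDl innerNl inner_dmap /tangent_part.
by rewrite mulmxKV ?gmx_unit // mxE subrr.
Qed.

(** The Gram matrix being invertible, products with the frame determine the tangential components.
    The linearity rules for the normal part come from this characterization. *)
Lemma normal_part_uniq w v : (forall j, inner (w - dmap c x p v) (e j) = 0) ->
  normal_part g x c p w = w - dmap c x p v.
Proof.
move=> wv; congr (_ - dmap _ _ _ _); rewrite /tangent_part.
rewrite (_ : \row_j _ = v *m gmx g c p) ?mulmxK ?gmx_unit //.
apply/rowP => j; rewrite mxE -inner_dmap; apply/eqP.
by rewrite -subr_eq0 -innerNl -innerDl wv.
Qed.

Lemma normal_part_id w : (forall j, inner w (e j) = 0) -> normal_part g x c p w = w.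
Proof.
by move=> w0; rewrite (@normal_part_uniq w 0) dmap0 subr0.
Qed.

Lemma normal_part_dmap u : normal_part g x c p (dmap c x p u) = 0.
Proof.
rewrite (@normal_part_uniq _ u) ?subrr // => j; exact: inner0l.
Qed.

Lemma normal_partD w w' :
  normal_part g x c p (w + w') = normal_part g x c p w + normal_part g x c p w'.
Proof.
pose t w := tangent_part g x c p w.
have E : w + w' - dmap c x p (t w + t w') =
    normal_part g x c p w + normal_part g x c p w'.
  by rewrite dmapD addrACA opprD.
rewrite -E; apply: normal_part_uniq => j.
by rewrite E innerDl !normal_part_orth addr0.
Qed.

Lemma normal_partZ (a : R) w :
  normal_part g x c p (a%:C *: w) = a%:C *: normal_part g x c p w.
Proof.
have E : a%:C *: w - dmap c x p (a *: tangent_part g x c p w) =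
    a%:C *: normal_part g x c p w.
  by rewrite dmapZ scalerBr.
rewrite -E; apply: normal_part_uniq => j.
by rewrite E innerZl normal_part_orth mulr0.
Qed.

Lemma normal_part_sum (I : Type) (r : seq I) (F : I -> 'rV[R[i]]_m) :
  normal_part g x c p (\sum_(b <- r) F b) = \sum_(b <- r) normal_part g x c p (F b).
Proof.
elim/big_ind2: _ => [|x1 x2 y1 y2 <- <-|//]; last by rewrite normal_partD.
by rewrite normal_part_id // => j; rewrite inner0l.
Qed.

Lemma normal_part_frame i : normal_part g x c p (e i) = 0.
Proof. by rewrite -dmap_delta normal_part_dmap. Qed.

Lemma second_form_sym i j : second_form g x c p i j = second_form g x c p j i.
Proof. by rewrite /second_form cpartial_commute. Qed.

End AtPoint.

Lemma partial_gmx c p i j l : atlas c -> dom c p ->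
  partial c i (fun q => gmx g c q j l) p =
  inner (cpartial c i (cpartial c j x) p) (cpartial c l x p) +
  inner (cpartial c j x p) (cpartial c i (cpartial c l x) p).
Proof.
move=> ac cp; rewrite -partial_inner //; [|exact: smooth_cdiff_partial..].
apply: near_eq_partial => //; apply: filterS (near_dom cp) => q cq.
exact: gmxE.
Qed.

(** The cancellation in the Koszul formula, with [D i j] standing for the second derivatives of [x]
    and [e] for its frame. *)
Let koszul (D : 'I_n -> 'I_n -> 'rV[R[i]]_m) (e : 'I_n -> 'rV[R[i]]_m) i j l :
  (forall i j, D i j = D j i) ->
  inner (D i j) (e l) + inner (e j) (D i l) +
    (inner (D j i) (e l) + inner (e i) (D j l)) -
    (inner (D l i) (e j) + inner (e i) (D l j)) = 2 * inner (D i j) (e l).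
Proof.
move=> Dsym; rewrite (Dsym j i) (Dsym l i) (Dsym l j) (innerC (e j)).
by move: (inner _ _) (inner _ _) (inner _ _) => r s t; ring.
Qed.

(** Since the metric is the Gram matrix of the frame, its derivatives combine into twice the product
    of a second derivative of [x] with a frame vector. *)
Lemma christoffelE c p i j k : atlas c -> dom c p ->
  christoffel g c p i j k = tangent_part g x c p (cpartial c i (cpartial c j x) p) 0 k.
Proof.
move=> ac cp; rewrite /christoffel /tangent_part mxE mulr_sumr.
apply: eq_bigr => l _; rewrite mxE !(partial_gmx _ _ _ ac cp).
rewrite (@koszul (fun i j => cpartial c i (cpartial c j x) p) (fun i => cpartial c i x p));
  last by move=> a b; exact: cpartial_commute.
(* The two sides use the inverse metric with its indices in opposite orders. *)
rewrite -[in RHS](ginv_sym ac cp) [in RHS]mxE.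
by move: (inner _ _) (ginv _ _ _ _ _) => r s; field.
Qed.

(** Gauss formula: the Christoffel terms are exactly the tangential part of the second
    derivative. *)
Lemma hessian_second_form c p i j : atlas c -> dom c p ->
  hessian g c x p i j = second_form g x c p i j.
Proof.
move=> ac cp; congr (_ - _); apply: eq_bigr => k _.
by rewrite christoffelE.
Qed.

(** This is [n H] computed in an arbitrary chart instead of the chosen one. *)
Definition second_form_trace c p : 'rV[R[i]]_m :=
  \sum_i \sum_j (ginv g c p i j)%:C *: second_form g x c p i j.

Lemma sum_sum_mxtrace (Q H : 'M[R]_n) :
  \sum_i \sum_j Q i j * H i j = \tr (Q *m H^T).
Proof.
by apply: eq_bigr => i _; rewrite mxE; apply: eq_bigr => j _; rewrite mxE.
Qed.

(* Changing charts adds to the second derivatives of x a combination of its first *)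
(* derivatives, which is tangent and hence invisible to the second fundamental    *)
(* form; the latter therefore transforms as a tensor.                             *)
Lemma second_form_trace_indep c d p : atlas c -> atlas d -> dom c p -> dom d p ->
  second_form_trace c p = second_form_trace d p.
Proof.
move=> ac ad cp dp.
(* [A] and [B] are the Jacobians of the two transition maps. *)
pose A := \matrix_(i, k) partial c i (fun q => coord d q 0 k) p.
pose B := \matrix_(i, k) partial d i (fun q => coord c q 0 k) p.
have gA : gmx g c p = A *m gmx g d p *m A^T by exact: gmx_tensor.
have uA : A \in unitmx.
  by have := gmx_unit ac cp; rewrite gA !unitmx_mul => /andP[/andP[]].
have giA : ginv g d p = A^T *m ginv g c p *m A.
  apply: (can_inj (mulmxK (gmx_unit ad dp))).
  rewrite /ginv mulVmx ?gmx_unit //.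
  have -> : gmx g d p = invmx A *m gmx g c p *m invmx A^T.
    by rewrite gA mulmxA mulmxK ?unitmx_tr // mulKmx.
  by rewrite !mulmxA mulmxK // mulmxKV ?gmx_unit // mulmxV ?unitmx_tr.
have frame q : dom c q -> dom d q -> forall j, cpartial c j x q =
    \sum_k (partial c j (fun q => coord d q 0 k) q)%:C *: cpartial d k x q.
  by move=> cq dq j; apply: cpartial_transition => //; exact: smooth_cdiff.
(* Both frames span the same tangent space, so the two normal projections agree. *)
have npE w : normal_part g x c p w = normal_part g x d p w.
  have E : w - dmap c x p (tangent_part g x d p w *m B) = normal_part g x d p w.
    congr (_ - _); rewrite /dmap.
    under [RHS]eq_bigr => k _ do rewrite
      (cpartial_transition k ad ac dp cp (smooth_cdiff ac smx cp)) scaler_sumr.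
    rewrite exchange_big; apply: eq_bigr => l _ /=.
    rewrite mxE rmorph_sum scaler_suml; apply: eq_bigr => k _.
    by rewrite [B _ _]mxE rmorphM scalerA.
  have orth j : inner (normal_part g x d p w) (cpartial c j x p) = 0.
    rewrite [cpartial c j x p]frame // inner_sumr big1 // => k _.
    by rewrite innerZr (normal_part_orth ad dp) mulr0.
  rewrite -[RHS]E; apply: (normal_part_uniq ac cp) => j.
  by rewrite [X in inner X _]E; exact: orth.
have hE i j : second_form g x c p i j =
    \sum_k \sum_l (A i l * A j k)%:C *: second_form g x d p l k.
  rewrite /second_form npE.
  have -> : cpartial c i (cpartial c j x) p = cpartial c i (fun q =>
      \sum_k (partial c j (fun q => coord d q 0 k) q)%:C *: cpartial d k x q) p.
    apply: near_eq_cpartial => //; near=> q.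
    by apply: frame; near: q; exact: near_dom.
  have dk k : cdiff_in c (cpartial d k x) p.
    by apply: (cdiff_in_transition ac ad) => //; exact: smooth_cdiff_partial.
  have da k : diff_in c (partial c j (fun q => coord d q 0 k)) p.
    exact: diff_in_partial_coord.
  rewrite cpartial_sum => [|k]; last exact: cdiff_inZ.
  rewrite normal_part_sum //; apply: eq_bigr => k _.
  (* Differentiating a coefficient leaves a multiple of a frame vector, whose normal part is
     zero. *)
  rewrite cpartialZ // normal_partD // !normal_partZ // normal_part_frame // scaler0 add0r.
  rewrite (cpartial_transition i ac ad) //; last exact: smooth_cdiff_partial.
  rewrite normal_part_sum // scaler_sumr; apply: eq_bigr => l _.
  by rewrite normal_partZ // scalerA -rmorphM !mxE mulrC.
apply: rcoord_inj => t; rewrite [LHS]rcoord_sum [RHS]rcoord_sum.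
pose H := \matrix_(l, k) rcoord t (second_form g x d p l k).
transitivity (\tr (ginv g c p *m (A *m H *m A^T)^T)).
  rewrite -sum_sum_mxtrace; apply: eq_bigr => i _; rewrite rcoord_sum.
  apply: eq_bigr => j _; rewrite rcoordZ; congr (_ * _).
  rewrite hE rcoord_sum mxE; apply: eq_bigr => k _.
  rewrite rcoord_sum !mxE mulr_suml; apply: eq_bigr => l _.
  by rewrite rcoordZ !mxE mulrAC.
(* Cyclicity of the trace moves [A^T] to the front, where it meets the transformation law of the
   inverse metric. *)
transitivity (\tr (ginv g d p *m H^T)).
  rewrite giA !trmx_mul trmxK !mulmxA mxtrace_mulC !mulmxA.
  by [].
rewrite -sum_sum_mxtrace; apply: eq_bigr => i _; rewrite rcoord_sum.
by apply: eq_bigr => j _; rewrite rcoordZ mxE.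
Unshelve. all: by end_near. Qed.

End ChartGeometry.

(** * The differential of the mean curvature *)

(** The algebra behind the formula for [dH]: [w] is to be [xi], [s] and [t] derivatives of [xi], [a]
    and [b] derivatives of [alpha], and [r] is [alpha]. Only the cross terms survive. *)
Lemma inner_Jop_comb (R : realType) (m : nat) (w s t y z : 'rV[R[i]]_m) (a b r ws wt : R) :
  y = a%:C *: w + r%:C *: s -> z = b%:C *: w + r%:C *: t -> inner (Jop s) t = 0 ->
  r * inner (Jop w) s = ws -> r * inner (Jop w) t = wt ->
  inner (Jop y) z = a * wt - b * ws.
Proof.
move=> -> -> st <- <-.
rewrite JopD !JopZ innerDl !innerDr !innerZl !innerZr st inner_Jop_self.
rewrite (inner_Jop s); move: (inner _ _) (inner _ _) => e f.
by ring.
Qed.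

(** Dependence as vanishing of all 2 by 2 minors, the form in which the products [<J dH, dH>]
    express it. *)
Lemma free_pair (F : fieldType) (n : nat) (v w : 'rV[F]_n) :
  ~~ free [:: v; w] <-> v^T *m w = w^T *m v.
Proof.
rewrite free_cons seq1_free span_seq1 negb_and !negbK; split.
  case/orP => [/vlineP[k ->]|/eqP ->]; last by rewrite trmx0 mul0mx mulmx0.
  by rewrite linearZ /= -scalemxAl -scalemxAr.
move=> vw; have [w0|/eqP/rowP w0] := eqVneq w 0; first by rewrite orbT.
rewrite orbF; apply/vlineP.
have [j wj] : exists j, w 0 j != 0.
  apply: contra_notP w0 => w0 j; apply/eqP; rewrite mxE; apply: contra_notT w0 => ?.
  by exists j.
exists (v 0 j / w 0 j); apply/rowP => i; rewrite mxE.
have /matrixP/(_ i j) := vw; rewrite !mxE !big_ord1 !mxE => E.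
by apply: (mulIf wj); rewrite E mulrAC divfK // mulrC.
Qed.

(** Allows dependence to be tested on covectors: [G] will be the inverse metric, which raises the
    indices. *)
Lemma gram_sym_mulmx (F : fieldType) (n : nat) (v w : 'rV[F]_n) (G : 'M[F]_n) :
  G \in unitmx ->
  (v *m G)^T *m (w *m G) = (w *m G)^T *m (v *m G) <-> v^T *m w = w^T *m v.
Proof.
move=> uG; rewrite !trmx_mul !mulmxA -!(mulmxA G^T); split=> [E|-> //].
have uGT : G^T \in unitmx by rewrite unitmx_tr.
by apply: (can_inj (mulmxK uG)); apply: (can_inj (mulKmx uGT)).
Qed.

(* The Hermitian Gram matrix of a totally real frame of C^n is real, so a frame *)
(* expansion has real coefficients as soon as the Hermitian products are real.  *)
Lemma totally_real_frame_span (R : realType) (n m : nat) (mn : m = n)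
    (e : 'I_n -> 'rV[R[i]]_m) (w : 'rV[R[i]]_m) :
  (\matrix_(i, j) inner (e i) (e j)) \in unitmx ->
  (forall i j, inner (Jop (e i)) (e j) = 0) ->
  (forall j, inner (Jop w) (e j) = 0) ->
  exists u : 'rV[R]_n, \sum_i (u 0 i)%:C *: e i = w.
Proof.
subst m; set G := \matrix_(_, _) _ => uG eJ wJ.
(* The imaginary part of the Hermitian product is [- inner (Jop u) v]. *)
have herm (u v : 'rV[R[i]]_n) : inner (Jop u) v = 0 ->
    \sum_k u 0 k * conjc (v 0 k) = (inner u v)%:C.
  rewrite /inner => uv; apply/eqP; rewrite eq_complex eqxx /=.
  rewrite -oppr_eq0 -uv; apply/eqP.
  rewrite (raddf_sum (@complex.Im R : {additive _ -> _})).
  rewrite (raddf_sum (@complex.Re R : {additive _ -> _})) -sumrN.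
  apply: eq_bigr => k _; rewrite mxE.
  by case: (u 0 k) (v 0 k) => [a b] [a' b'] /=; ring.
pose E := \matrix_(i, k) e i 0 k; pose E' := \matrix_(k, i) conjc (e i 0 k).
have EE' : E *m E' = map_mx (real_complex R) G.
  apply/matrixP => i j; rewrite !mxE -herm //.
  by apply: eq_bigr => k _; rewrite !mxE.
(* Here [m = n] enters: [E] is square, so its right inverse is also a left inverse. *)
have {}EE' : E' *m invmx (map_mx (real_complex R) G) *m E = 1%:M.
  by apply: mulmx1C; rewrite mulmxA EE' mulmxV // map_unitmx.
pose r := \row_j inner w (e j).
have wE' : w *m E' = map_mx (real_complex R) r.
  apply/rowP => j; rewrite !mxE -herm //.
  by apply: eq_bigr => k _; rewrite !mxE.
exists (r *m invmx G); rewrite -[RHS]mulmx1 -EE' !mulmxA wE' -map_invmx -map_mxM.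
apply/rowP => k; rewrite summxE mxE; apply: eq_bigr => i _.
by rewrite !mxE.
Qed.

(** * The Laplace map and parallel mean curvature *)

Section LaplaceMap.
Context (R : realType) (n m : nat) (M : manifold R n) (g : metric M).
Context (x : M -> 'rV[R[i]]_m).
Hypothesis isox : isometric_immersion g x.
Hypothesis trx : totally_real x.
Implicit Types (c : chart R n M) (p q : M) (i j k : 'I_n) (u v : 'rV[R]_n).

Local Notation H := (mean_curvature g x).
Local Notation alpha := (mean_curvature_fun g x).
Local Notation xi := (unit_mean_curvature g x).

Lemma chart_atP p : atlas (chart_at p) /\ dom (chart_at p) p.
Proof. exact: svalP (cid2 (atlas_cover p)). Qed.

(** The chart [chart_at p] varies uncontrollably with [p]; fixing one chart near a point is what
    allows [H] to be differentiated. *)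
Lemma mean_curvatureE c p : atlas c -> dom c p ->
  H p = (n%:R^-1)%:C *: second_form_trace g x c p.
Proof.
move=> ac cp; have [ac' cp'] := chart_atP p.
by rewrite (second_form_trace_indep isox ac ac').
Qed.

Lemma laplace_mapE : laplace_map g x = fun p => (- n%:R)%:C *: H p.
Proof.
apply/funext => p; have [ac cp] := chart_atP p.
rewrite (mean_curvatureE ac cp) scalerA -rmorphM mulNr rmorphN scaleNr.
rewrite /laplace_map /laplacian; congr (- _).
transitivity (second_form_trace g x (chart_at p) p).
  by apply: eq_bigr => i _; apply: eq_bigr => j _; rewrite (hessian_second_form isox).
(* For [n = 0] the inverse of [n] is 0 and does not cancel, but the trace is an empty sum. *)
have [n0|n0] := eqVneq n 0%N.
  have no_index (i : 'I_n) : False by have := ltn_ord i; rewrite [X in (_ < X)%N]n0 ltn0.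
  by rewrite /second_form_trace !big1 ?scaler0 // => i; case: (no_index i).
by rewrite mulfV ?scale1r // pnatr_eq0.
Qed.

Lemma mean_curvature_normal c p j : atlas c -> dom c p ->
  inner (H p) (cpartial c j x p) = 0.
Proof.
move=> ac cp; rewrite (mean_curvatureE ac cp) innerZl inner_suml.
rewrite big1 ?mulr0 // => k _; rewrite inner_suml big1 // => l _.
by rewrite innerZl (normal_part_orth isox) ?mulr0.
Qed.

Lemma diff_in_ginv c p i j : atlas c -> dom c p ->
  diff_in c (fun q => ginv g c q i j) p.
Proof.
move=> ac cp; apply: diff_in_invmx => // [q cq|k l]; first exact: gmx_unit.
by apply: smooth_in_diff => //; exact: gmx_smooth.
Qed.

Lemma cdiff_in_second_form c p i j : atlas c -> dom c p ->
  cdiff_in c (fun q => second_form g x c q i j) p.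
Proof.
move=> ac cp; have sx := isometric_smooth isox.
have d2 : cdiff_in c (cpartial c i (cpartial c j x)) p by exact: smooth_cdiff_partial2.
have d1 k : cdiff_in c (cpartial c k x) p by exact: smooth_cdiff_partial.
apply: cdiff_inD => //; apply: cdiff_inN; apply: cdiff_in_sum => k.
apply: cdiff_inZ => //; under eq_fun do rewrite mxE.
apply: diff_in_sum => l; apply: diff_inM; last exact: diff_in_ginv.
by under eq_fun do rewrite mxE; exact: diff_in_inner.
Qed.

Lemma cdiff_in_mean_curvature c p : atlas c -> dom c p -> cdiff_in c H p.
Proof.
move=> ac cp; apply: (@near_eq_cdiff_in _ _ _ _ _ _
  (fun q => (n%:R^-1)%:C *: second_form_trace g x c q)) => //.
  by apply: filterS (near_dom cp) => q cq; rewrite (mean_curvatureE ac cq).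
apply: cdiff_inZ; first exact: diff_in_cst.
apply: cdiff_in_sum => i; apply: cdiff_in_sum => j.
by apply: cdiff_inZ; [exact: diff_in_ginv|exact: cdiff_in_second_form].
Qed.

Lemma dmap_laplace_map c p u : atlas c -> dom c p ->
  dmap c (laplace_map g x) p u = (- n%:R)%:C *: dmap c H p u.
Proof.
move=> ac cp; rewrite laplace_mapE scaler_sumr; apply: eq_bigr => i _.
rewrite cpartialZ //; last exact: cdiff_in_mean_curvature.
by rewrite partial_cst scale0r add0r !scalerA mulrC.
Qed.

(** Each [dH(u)] equals its tangential part, so total reality of [x] applies to it. *)
Lemma totally_real_parallel : parallel_normal g x H -> totally_real (laplace_map g x).
Proof.
move=> parH c p ac cp u v; rewrite !dmap_laplace_map // JopZ innerZl innerZr.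
have tangent w : dmap c H p w = dmap c x p (tangent_part g x c p (dmap c H p w)).
  by apply/eqP; rewrite -subr_eq0; apply/eqP; exact: parH.
by rewrite (tangent u) (tangent v) trx // !mulr0.
Qed.

(** * Parallel unit mean curvature in the Lagrangian case *)

Section NormalizedParallel.
Hypothesis mn : m = n.
Hypothesis pnmc : parallel_normalized_mean_curvature g x.

Let H_neq0 p : H p != 0 := pnmc.1 p.

Let alpha_gt0 p : 0 < alpha p.
Proof. by rewrite sqrtr_gt0 inner_gt0. Qed.

Let alpha_xi p : H p = (alpha p)%:C *: xi p.
Proof. by rewrite scalerA -rmorphM mulfV ?scale1r // gt_eqF. Qed.

Section AtPoint.
Variables (c : chart R n M) (p : M).
Hypotheses (ac : atlas c) (cp : dom c p).

Local Notation e i := (cpartial c i x p).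
Local Notation da := (\row_i partial c i alpha p).
Local Notation S := (\matrix_(i, j) inner (second_form g x c p i j) (H p)).

(** Nonvanishing of [H] keeps the square root away from its singularity at 0. *)
Let diff_alpha : diff_in c alpha p.
Proof.
apply: diff_in_sqrt => //; first by rewrite inner_gt0.
by apply: diff_in_inner; exact: cdiff_in_mean_curvature.
Qed.

Let cdiff_xi : cdiff_in c xi p.
Proof.
apply: cdiff_inZ; last exact: cdiff_in_mean_curvature.
by apply: diff_inV => //; rewrite gt_eqF.
Qed.

Let xi_normal q j : dom c q -> inner (xi q) (cpartial c j x q) = 0.
Proof. by move=> cq; rewrite innerZl mean_curvature_normal // mulr0. Qed.

Let xi_tangent i : exists v, cpartial c i xi p = dmap c x p v.
Proof.
exists (tangent_part g x c p (cpartial c i xi p)); apply/eqP; rewrite -subr_eq0.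
by apply/eqP; have := pnmc.2 c p ac cp (delta_mx 0 i); rewrite dmap_delta.
Qed.

(** Weingarten formula, from differentiating the orthogonality of [xi] to the frame. The factor
    [(alpha p)^-1] appears because [S] is taken along [H], not [xi]. *)
Let weingarten i j : inner (cpartial c i xi p) (e j) = - (alpha p)^-1 * S i j.
Proof.
have : partial c i (fun q => inner (xi q) (cpartial c j x q)) p = 0.
  rewrite -(partial_cst c p 0 i); apply: near_eq_partial => //.
  by apply: filterS (near_dom cp) => q cq; rewrite xi_normal.
have sx := isometric_smooth isox.
rewrite partial_inner //; last exact: smooth_cdiff_partial.
move/eqP; rewrite addr_eq0 => /eqP ->; rewrite mulNr; congr (- _).
(* The second derivative differs from its normal part by a tangent vector, orthogonal to [xi]. *)
rewrite mxE innerC -innerZr -/(xi p) /second_form /normal_part innerDl innerNl inner_dmapl.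
by rewrite big1 ?subr0 // => k _; rewrite (innerC (e k)) xi_normal // mulr0.
Qed.

(** As [J(JH) = - H] is normal, the Hermitian products of [JH] with the frame are real, and the
    frame spans it over the reals. *)
Let JH_tangent : exists u, dmap c x p u = Jop (H p).
Proof.
apply: (totally_real_frame_span mn) => [|i j|j].
- rewrite (_ : \matrix_(_, _) _ = gmx g c p); first exact: (gmx_unit g ac cp).
  by apply/matrixP => i j; rewrite mxE (gmxE isox).
- by rewrite -!dmap_delta trx.
- have -> : Jop (Jop (H p)) = - H p.
    by rewrite /Jop scalerA (_ : _ * _ = -1) ?scaleN1r //; exact: sqr_i.
  by rewrite innerNl mean_curvature_normal // oppr0.
Qed.

(** The row [u *m S] is the covector [<A_H JH, .>] and [da] is the differential of [alpha]. *)
Let inner_J_dH u : dmap c x p u = Jop (H p) -> forall i j,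
  inner (Jop (cpartial c i H p)) (cpartial c j H p) =
  (alpha p)^-1 * ((u *m S) 0 i * da 0 j - da 0 i * (u *m S) 0 j).
Proof.
move=> uJ.
have dHE i : cpartial c i H p =
    (da 0 i)%:C *: xi p + (alpha p)%:C *: cpartial c i xi p.
  rewrite [X in X%:C]mxE.
  transitivity (cpartial c i (fun q => (alpha q)%:C *: xi q) p); last exact: cpartialZ.
  apply: (near_eq_cpartial _ cp); apply: nearW => q.
  exact (alpha_xi q).
have JT j : inner (Jop (H p)) (cpartial c j xi p) = - (alpha p)^-1 * (u *m S) 0 j.
  rewrite -uJ inner_dmapl mxE mulr_sumr; apply: eq_bigr => k _.
  rewrite innerC weingarten mulrCA; congr (_ * (_ * _)); rewrite !mxE.
  by rewrite (second_form_sym isox).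
move=> i j; have [vi Ti] := xi_tangent i; have [vj Tj] := xi_tangent j.
have TT : inner (Jop (cpartial c i xi p)) (cpartial c j xi p) = 0.
  by rewrite Ti Tj trx.
(* The factor [alpha] turns [J xi] back into [JH], to which [JT] applies. *)
have JxiT k : alpha p * inner (Jop (xi p)) (cpartial c k xi p) =
    - (alpha p)^-1 * (u *m S) 0 k.
  by rewrite -JT -innerZl -JopZ -(alpha_xi p).
etransitivity; first exact (inner_Jop_comb (dHE i) (dHE j) TT (JxiT i) (JxiT j)).
move: (da 0 i) (da 0 j) ((u *m S) 0 i) ((u *m S) 0 j) (alpha p)^-1 => ai aj si sj r.
by ring.
Qed.

(** On pairs of frame vectors the condition says that the minors of [u *m S] and [da] vanish;
    raising indices gives [A_H JH] and the gradient. *)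
Lemma totally_real_at_iff :
  (forall u v, inner (Jop (dmap c (laplace_map g x) p u))
                     (dmap c (laplace_map g x) p v) = 0) <->
  exists u, dmap c x p u = Jop (H p) /\
    ~~ free [:: shape g x c p (H p) u; gradient g c alpha p].
Proof.
(* C^0 has no nonzero vector, so [H p != 0] forces [m], hence [n], to be positive, and the factor
   [- n] can be cancelled. *)
have n0 : n%:R != 0 :> R.
  rewrite pnatr_eq0 -mn; apply: contraNneq (H_neq0 p) => m0.
  by apply/eqP/rowP => k; have := ltn_ord k; rewrite [X in (_ < X)%N]m0 ltn0.
have [w wJ] := JH_tangent; have K := inner_J_dH wJ.
have uG : ginv g c p \in unitmx by rewrite unitmx_inv (gmx_unit g ac cp).
have depE u : ~~ free [:: shape g x c p (H p) u; gradient g c alpha p] <->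
    (u *m S)^T *m da = da^T *m (u *m S).
  exact: iff_trans (free_pair _ _) (gram_sym_mulmx _ _ uG).
split.
  move=> Lr; exists w; split=> //; apply/depE/matrixP => i j.
  have := Lr (delta_mx 0 i) (delta_mx 0 j).
  rewrite !dmap_laplace_map // JopZ innerZl innerZr !dmap_delta K.
  move=> /eqP; rewrite !mulf_eq0 oppr_eq0 (negPf n0) invr_eq0 gt_eqF //= subr_eq0.
  by move=> /eqP E; rewrite ![LHS]mxE ![RHS]mxE !big_ord1 ![_^T _ _]mxE.
move=> [u [uJ /depE/matrixP dep]] v v'.
rewrite !dmap_laplace_map // JopZ innerZl innerZr.
rewrite Jop_sum inner_suml big1 ?mulr0 // => i _.
rewrite JopZ innerZl inner_sumr big1 ?mulr0 // => j _.
rewrite innerZr (inner_J_dH uJ); have := dep i j.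
rewrite ![LHS]mxE ![RHS]mxE !big_ord1 ![_^T _ _]mxE => ->.
by rewrite subrr !mulr0.
Qed.

End AtPoint.

Lemma totally_real_iff_shape :
  totally_real (laplace_map g x) <-> shape_JH_parallel_gradient g x.
Proof.
split=> Lr c p ac cp; have [to from] := totally_real_at_iff ac cp.
  by apply: to => u v; exact: Lr.
by apply: from; exact: Lr.
Qed.

End NormalizedParallel.

End LaplaceMap.

Theorem theorem4p2 (R : realType) (n m : nat) (M : manifold R n)
    (g : metric M) (x : M -> 'rV[R[i]]_m)
    (connM : connected [set: M]%classic)
    (isox : isometric_immersion g x)
    (trx : totally_real x) :
  (parallel_normal g x (mean_curvature g x) ->
     totally_real (laplace_map g x)) /\
  (m = n -> parallel_normalized_mean_curvature g x ->
     (totally_real (laplace_map g x) <-> shape_JH_parallel_gradient g x)).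
Proof.
split; first exact: totally_real_parallel.
by move=> mn pnmc; exact: totally_real_iff_shape.
Qed.
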